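(* Let $A$ and $B$ be linear differential operators on $\mathbb R^d$. If $B$ is locally solvable and $A$ is a differential post-transmutation of $B$, then $A$ is locally solvable.
   Context: Let $d,n,m,p,q\in\mathbb N^*$. A linear differential operator on $\mathbb R^d$ is a finite-order linear differential operator $\sum_{|\alpha|\le k}C_\alpha(x)\partial^\alpha$ with $C^\infty$ matrix-valued coefficients on $\mathbb R^d$. Here $A: \mathcal E\to\mathcal F$, $B:\mathcal G\to\mathcal H$ with $\mathcal E=C^\infty(\mathbb R^d;\mathbb R^n)$, $\mathcal F=C^\infty(\mathbb R^d;\mathbb R^m)$, $\mathcal G=C^\infty(\mathbb R^d;\mathbb R^p)$, $\mathcal H=C^\infty(\mathbb R^d;\mathbb R^q)$. Such operators also act on (vector-valued) smooth functions and distributions on any open subset of $\mathbb R^d$. $A$ is a differential post-transmutation of $B$ if there are linear differential operators with $C^\infty$ coefficients $P:\mathcal G\to\mathcal E$, $R:\mathcal H\to\mathcal F$, $S:\mathcal F\to\mathcal H$, $T:\mathcal F\to\mathcal E$ such that $AP=RB$ and $RS+AT=\mathrm{Id}_{\mathcal F}$. A linear differential operator $A$ is locally solvable if for any non-empty open subset $\Omega$ of $\mathbb R^d$ and any $f$ which is $C^\infty$ in $\Omega$ (with values in the target space of $A$), there is a distribution $u$ on $\Omega$ satisfying $Au=f$ in $\Omega$. *)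

(* Defs.v *)
From HB Require Import structures.
From mathcomp Require Import all_boot all_order all_algebra.
From mathcomp Require Import all_classical all_reals all_analysis.
Set Implicit Arguments.
Unset Strict Implicit.
Unset Printing Implicit Defensive.
Import Order.TTheory GRing.Theory Num.Theory.
Import numFieldNormedType.Exports.
Local Open Scope classical_set_scope.
Local Open Scope ring_scope.

Section SmoothFunctions.
Context {R : realType} {d : nat}.
Implicit Types (f : 'rV[R]_d -> R) (Omega : set 'rV[R]_d).

Definition pderiv (i : 'I_d) f : 'rV[R]_d -> R :=
  fun x => 'D_(delta_mx 0 i) f x.

(* A function on an open set Omega is represented by a total function whose
   values outside Omega are never constrained. *)
Definition smooth_on Omega f : Prop :=
  forall (s : seq 'I_d) (x : 'rV[R]_d), Omega x ->
    {for x, continuous (foldr pderiv f s)} /\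
    forall i : 'I_d, derivable (foldr pderiv f s) x (delta_mx 0 i).

Definition smooth_vec_on (n : nat) Omega (f : 'rV[R]_d -> 'cV[R]_n) : Prop :=
  forall j : 'I_n, smooth_on Omega (fun x => f x j 0).

(* The order in which the variables are differentiated is fixed; it is
   irrelevant on smooth functions. *)
Definition mderiv (a : 'I_d -> nat) f : 'rV[R]_d -> R :=
  foldr (fun i g => iter (a i) (pderiv i) g) f (enum 'I_d).

End SmoothFunctions.

Notation multi_index d k :=
  {a : {ffun 'I_d -> 'I_k.+1} | (\sum_(i < d) a i <= k)%N}.

Definition mexp (d k : nat) (a : multi_index d k) : 'I_d -> nat :=
  fun i => val a i.

Definition mdeg (d k : nat) (a : multi_index d k) : nat :=
  (\sum_(i < d) mexp a i)%N.

(* Operators from C^oo(R^d; R^n) to C^oo(R^d; R^m). *)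
Record diffop (R : realType) (d n m : nat) := DiffOp {
  do_order : nat;
  do_coef : multi_index d do_order -> 'rV[R]_d -> 'M[R]_(m, n);
  do_coef_smooth : forall a i j,
    smooth_on [set: 'rV[R]_d] (fun x => do_coef a x i j) }.
Arguments do_order {R d n m} A : rename.
Arguments do_coef {R d n m} A a x : rename.

Section Action.
Context {R : realType} {d n m : nat}.

Definition diffop_fun (A : diffop R d n m) (u : 'rV[R]_d -> 'cV[R]_n) :
    'rV[R]_d -> 'cV[R]_m :=
  fun x => \sum_(a : multi_index d (do_order A))
    do_coef A a x *m \col_(j < n) mderiv (mexp a) (fun y => u y j 0) x.

End Action.

Coercion diffop_fun : diffop >-> Funclass.

Section Distributions.
Context {R : realType} {d : nat}.
Implicit Types (phi : 'rV[R]_d -> R) (Omega K : set 'rV[R]_d).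

Definition supp phi : set 'rV[R]_d := closure [set x | phi x != 0].

Definition test_function Omega phi : Prop :=
  [/\ smooth_on [set: 'rV[R]_d] phi, compact (supp phi) &
      supp phi `<=` Omega].

(* Only the values on test functions on Omega are meaningful. *)
Record distribution_on Omega := DistributionOn {
  dist_fun :> ('rV[R]_d -> R) -> R;
  dist_linear : forall (c : R) phi psi,
    test_function Omega phi -> test_function Omega psi ->
    dist_fun (fun x => c * phi x + psi x) = c * dist_fun phi + dist_fun psi;
  dist_continuous : forall K, compact K -> K `<=` Omega ->
    exists (C : R) (N : nat), forall phi,
      test_function Omega phi -> supp phi `<=` K ->
      `|dist_fun phi| <=
        C * \sum_(a : multi_index d N)
              sup (range (fun x => `|mderiv (mexp a) phi x|)) }.

Definition dist_mderiv k (a : multi_index d k)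
    (u : ('rV[R]_d -> R) -> R) : ('rV[R]_d -> R) -> R :=
  fun phi => (-1) ^+ mdeg a * u (mderiv (mexp a) phi).

Definition dist_mul (c : 'rV[R]_d -> R)
    (u : ('rV[R]_d -> R) -> R) : ('rV[R]_d -> R) -> R :=
  fun phi => u (fun x => c x * phi x).

Definition diffop_dist n m (A : diffop R d n m)
    (u : 'I_n -> ('rV[R]_d -> R) -> R) : 'I_m -> ('rV[R]_d -> R) -> R :=
  fun i phi => \sum_(a : multi_index d (do_order A)) \sum_(j < n)
    dist_mul (fun x => do_coef A a x i j) (dist_mderiv a (u j)) phi.

End Distributions.

(* Iterated Lebesgue integral over R^d. It is only applied to continuous
   functions with compact support, for which it is the integral with respect
   to d-dimensional Lebesgue measure. *)
Fixpoint integral_rV (R : realType) (d : nat) : ('rV[R]_d -> R) -> R :=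
  match d with
  | 0 => fun f => f 0
  | d'.+1 => fun f => (\int[@lebesgue_measure R]_t
      integral_rV (fun v : 'rV[R]_d' => f (row_mx (t%:M : 'rV[R]_1) v)))%R
  end.

Definition dist_of_fun (R : realType) (d : nat) (f : 'rV[R]_d -> R) :
    ('rV[R]_d -> R) -> R :=
  fun phi => integral_rV (fun x => f x * phi x).

Definition locally_solvable (R : realType) (d n m : nat)
    (A : diffop R d n m) : Prop :=
  forall Omega : set 'rV[R]_d, open Omega -> Omega !=set0 ->
  forall f : 'rV[R]_d -> 'cV[R]_m, smooth_vec_on Omega f ->
  exists u : 'I_n -> distribution_on Omega,
    forall (i : 'I_m) (phi : 'rV[R]_d -> R), test_function Omega phi ->
      diffop_dist A (fun j => u j) i phi = dist_of_fun (fun x => f x i 0) phi.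

Definition post_transmutation (R : realType) (d n m p q : nat)
    (A : diffop R d n m) (B : diffop R d p q) : Prop :=
  exists (P : diffop R d p n) (Q : diffop R d q m)
         (S : diffop R d m q) (T : diffop R d m n),
    (forall g : 'rV[R]_d -> 'cV[R]_p, smooth_vec_on setT g ->
       forall x, A (P g) x = Q (B g) x) /\
    (forall f : 'rV[R]_d -> 'cV[R]_m, smooth_vec_on setT f ->
       forall x, Q (S f) x + A (T f) x = f x).

(* Main.v *)
(* The transpose A^t of a differential operator satisfies <A u, w> = <u, A^t w>
   for distributions u, by definition, and for smooth u by integration by parts.
   Testing A P = Q B and Q S + A T = Id (the paper's R is called Q) against test
   vectors w by duality gives P^t A^t w = B^t Q^t w and S^t Q^t w + T^t A^t w = w;
   thus identities known only for globally smooth functions become usable on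
   every open set, without cut-off functions.  If B u = S f on Omega, then v = P u + T f satisfies
     <A v, w> = <u, P^t A^t w> + <f, T^t A^t w> = <B u, Q^t w> + <f, T^t A^t w>
              = <f, S^t Q^t w + T^t A^t w> = <f, w>. *)

Require Import Defs.
From mathcomp Require Import all_boot all_order all_algebra.
From mathcomp Require Import all_classical all_reals all_analysis.
From mathcomp Require Import lra.
Set Implicit Arguments.
Unset Strict Implicit.
Unset Printing Implicit Defensive.
Import Order.TTheory GRing.Theory Num.Theory.
Import numFieldNormedType.Exports.
Local Open Scope classical_set_scope.
Local Open Scope ring_scope.

(** * Integration of continuous functions vanishing outside a ball *)

(** The integral is an iterated one-dimensional one, so integration by parts is derived from
    translation invariance, which passes through the iteration one coordinate at a time. Testing by
    duality is conclusive because the difference of two test vectors is itself an admissible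
    globally smooth vector: paired with itself it gives a sum of integrals of squares, and a
    continuous nonnegative function with zero integral vanishes. A function on [Omega] is arbitrary
    outside [Omega]. Calculus rules are therefore applied only on the support of a test function,
    and off the support every term is zero. [mderiv] takes derivatives in a fixed order, whereas
    integration by parts and the composition of derivatives rearrange them; hence the symmetry of
    mixed derivatives. Finally, [v] has to satisfy the seminorm bounds in the definition of a
    distribution, which rest on a Leibniz estimate with coefficients bounded on compact subsets of
    [Omega]. *)

Definition cc (R : realType) (V : normedModType R) (M : R) (f : V -> R) : Prop :=
  continuous f /\ forall x, M < `|x| -> f x = 0.

Section Continuity.
Context {R : realType} {V : normedModType R}.
Implicit Types (f g : V -> R) (x : V).

Lemma continuous_atD f g x :
  {for x, continuous f} -> {for x, continuous g} ->
  {for x, continuous (fun y => f y + g y)}.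
Proof. by move=> cf cg; exact: (cvgD cf cg). Qed.

Lemma continuous_atM f g x :
  {for x, continuous f} -> {for x, continuous g} ->
  {for x, continuous (fun y => f y * g y)}.
Proof. by move=> cf cg; exact: (cvgM cf cg). Qed.

Lemma continuous_at_cst (c : R) x : {for x, continuous (fun=> c)}.
Proof. exact: cst_continuous. Qed.

Lemma continuous_at_shift f (w x : V) : {for x + w, continuous f} ->
  {for x, continuous (fun y => f (y + w))}.
Proof.
apply: (@continuous_comp _ _ _ (fun t => t + w) f).
by apply: cvgD; [exact: cvg_id|exact: cvg_cst].
Qed.

Lemma cc_lin M (c : R) f g : cc M f -> cc M g ->
  cc M (fun x => c * f x + g x).
Proof.
move=> [cf f0] [cg g0]; split=> [x|x Mx]; last by rewrite f0// g0// mulr0 addr0.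
apply: continuous_atD (cg x).
exact: continuous_atM (@continuous_at_cst c x) (cf x).
Qed.

Lemma cc_shift M f w : cc M f -> cc (M + `|w|) (fun x => f (x + w)).
Proof.
move=> [cf f0]; split=> [x|x Mx]; first exact: continuous_at_shift (cf (x + w)).
by apply: f0; have := ler_normB (x + w) w; rewrite addrK => ?; lra.
Qed.

Lemma cc_le M N f : M <= N -> cc M f -> cc N f.
Proof. by move=> MN [cf f0]; split => // x Nx; apply: f0; exact: le_lt_trans Nx. Qed.

(** The radius in [cc] carries no sign condition; this supplies a nonnegative one for estimates that
    use it as half the side of a cube. *)
Lemma cc_max M f : cc M f -> cc (Num.max M 0) f.
Proof. by apply: cc_le; rewrite le_max lexx. Qed.

End Continuity.

(** * Integrals over the real line *)

Section Integral1.
Context {R : realType}.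
Local Notation mu := (@lebesgue_measure R).
Implicit Types (f g : R -> R) (M C : R).

Lemma cc_restrict M f : cc M f -> f = f \_ (`[- M, M]%classic).
Proof.
move=> [_ f0]; apply/funext => x; rewrite patchE; case: ifPn => //.
rewrite notin_setE/= in_itv/= -ler_norml => /negP; rewrite -ltNge; exact: f0.
Qed.

Lemma cc_Rintegral M f : cc M f ->
  (\int[mu]_t f t)%R = (\int[mu]_(t in `[(- M)%R, M]) f t)%R.
Proof. by move=> /cc_restrict fE; rewrite {1}fE -Rintegral_mkcond. Qed.

Lemma continuous_integrable_itv f a b : continuous f ->
  mu.-integrable `[a, b]%classic (EFin \o f).
Proof.
move=> cf; apply: continuous_compact_integrable; first exact: segment_compact.
exact: continuous_subspaceT.
Qed.

Lemma cc_integrable M f : cc M f -> mu.-integrable setT (EFin \o f).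
Proof.
move=> cf; rewrite (cc_restrict cf) -restrict_EFin.
apply/(integrable_mkcond _ _).1 => //.
exact: continuous_integrable_itv cf.1.
Qed.

Lemma cc_Rintegral_le M f C : 0 <= M -> cc M f -> (forall t, `|f t| <= C) ->
  `|(\int[mu]_t f t)%R| <= M *+ 2 * C.
Proof.
move=> M0 cf fC; rewrite (cc_Rintegral cf).
apply: (le_trans (le_normr_Rintegral _ (continuous_integrable_itv _ _ cf.1))) => //.
apply: (@le_trans _ _ (\int[mu]_(t in `[(- M)%R, M]) C)%R).
  apply: le_Rintegral => //.
  - apply: (@continuous_integrable_itv (fun t => `|f t|)) => t.
    by apply: continuous_comp; [exact: cf.1|exact: norm_continuous].
  - by apply: (@continuous_integrable_itv (fun=> C)); exact: cst_continuous.
rewrite Rintegral_cst//= lebesgue_measure_itv/= lte_fin.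
case: ltP => /= MM; first by rewrite opprK mulrC mulr2n.
(* Here [M <= - M], so the interval is a single point and has measure zero. *)
have /eqP -> : M == 0 by rewrite eq_le M0 andbT; lra.
by rewrite mulr0 mul0rn mul0r.
Qed.

(** By continuity a positive value [f t0] keeps [f] above [f t0 / 2] on a closed interval around
    [t0], which bounds the integral below by a positive number. *)
Lemma cc_Rintegral_eq0 M f : cc M f -> (forall t, 0 <= f t) ->
  (\int[mu]_t f t)%R = 0 -> forall t, f t = 0.
Proof.
move=> cf f0 If0 t0; apply/eqP; rewrite eq_le f0 andbT leNgt; apply/negP => ft0.
have : \forall t \near t0, f t0 / 2 < f t.
  by move: (cf.1 t0) => /cvgr_gt; apply; lra.
move=> /nbhs_closedballP[/= e eball].
have e0 : 0 < e%:num by [].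
suff : 0 < (\int[mu]_t f t)%R by rewrite If0 ltxx.
apply: (@lt_le_trans _ _ (\int[mu]_(t in `[t0 - e%:num, t0 + e%:num]) (f t0 / 2))%R).
  rewrite Rintegral_cst//= lebesgue_measure_itv/= lte_fin ifT; last by lra.
  by rewrite /= mulr_gt0//; lra.
apply: (@le_trans _ _ (\int[mu]_(t in `[t0 - e%:num, t0 + e%:num]) f t)%R).
  apply: le_Rintegral => //.
  - by apply: (@continuous_integrable_itv (fun=> _)); exact: cst_continuous.
  - exact: continuous_integrable_itv cf.1.
  - move=> t tI; apply/ltW/eball; rewrite closed_ballE//= /closed_ball_/=.
    by move: tI; rewrite /= in_itv/= ler_norml => /andP[? ?]; apply/andP; split; lra.
rewrite [leLHS]Rintegral_mkcond; apply: le_Rintegral => //.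
- rewrite -restrict_EFin; apply/(integrable_mkcond _ _).1 => //.
  exact: continuous_integrable_itv cf.1.
- exact: cc_integrable cf.
- by move=> t _; rewrite patchE; case: ifP.
Qed.

(** Vanishing far out reduces the claim to the substitution [t + c] on a compact interval. *)
Lemma cc_Rintegral_shift M f c : cc M f ->
  (\int[mu]_t f (t + c))%R = (\int[mu]_t f t)%R.
Proof.
move=> cf.
pose N : R := `|M| + `|c|.
have cfN : cc N f.
  by apply: cc_le cf; rewrite (le_trans (ler_norm M))// lerDl.
pose g t := f (t + c).
have cg : cc (N + `|c|) g by exact: cc_shift.
(* The translated interval still contains [[-N, N]], so restricting [f] to it changes nothing. *)
have : f \_ (`[- (N + `|c|) + c, (N + `|c|) + c]%classic) = f.
  apply/funext => x; rewrite patchE; case: ifPn => //.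
  rewrite notin_setE/= in_itv/= => xI; apply/esym/cfN.2; rewrite ltNge.
  apply/negP => xN; apply: xI; move: xN; rewrite ler_norml => /andP[? ?].
  have := ler_norm c; have := ler_norm (- c); rewrite normrN => ? ?.
  by apply/andP; split; lra.
move=> fE; rewrite (cc_Rintegral cg) -[in RHS]fE -Rintegral_mkcond.
congr fine.
have dF (t : R) : is_derive t (1 : R) (fun t : R => t + c) (1 : R).
  by apply: is_derive_eq; rewrite addr0.
have F'E : (fun t : R => t + c)^`()%classic = cst 1.
  by apply/funext => t; rewrite derive1E; apply: derive_val.
rewrite (@integration_by_substitution_increasing _ (fun t : R => t + c) f
  (- (N + `|c|)) (N + `|c|)).
- by apply: eq_integral => x _; rewrite F'E /= /GRing.mul/= mulr1.
- have : 0 <= N + `|c| by rewrite !addr_ge0.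
  by move=> ?; lra.
- by move=> x y _ _ xy; rewrite ltrD2r.
- by rewrite F'E => x _; exact: cst_continuous.
- by rewrite F'E; exact: is_cvg_cst.
- by rewrite F'E; exact: is_cvg_cst.
- have cF : continuous (fun t : R => t + c).
    by move=> x; apply: cvgD; [exact: cvg_id|exact: cvg_cst].
  split.
  + by move=> x _; apply: ex_derive.
  + by apply: cvg_at_right_filter; exact: cF.
  + by apply: cvg_at_left_filter; exact: cF.
- exact: continuous_subspaceT cf.1.
Qed.

End Integral1.

(** * The sup norm on row vectors and uniform continuity *)

Section Uniform.
Context {R : realType}.

Lemma continuousP_norm (V : normedModType R) (f : V -> R) :
  (forall x (e : R), 0 < e ->
     exists2 r : R, 0 < r & forall h, `|h| < r -> `|f (x + h) - f x| < e) ->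
  continuous f.
Proof.
move=> cf x; apply/cvgrPdist_lt => e e0.
have [r r0 fr] := cf x e e0; apply/nbhs_normP; exists r => //= y /=.
by rewrite /= => xyr; rewrite distrC -(subrKC x y) fr// distrC.
Qed.

Lemma nbhs_norm_lt (V : normedModType R) (x : V) (r : R) : 0 < r ->
  nbhs x [set y | `|x - y| < r].
Proof. by move=> r0; apply/nbhs_normP; exists r. Qed.

Lemma coord_le_norm m n (x : 'M[R]_(m, n)) i j : `|x i j| <= `|x|.
Proof.
rewrite [leRHS]/Num.Def.normr /= mx_normrE; apply/bigmax_geP; right => /=.
by exists (i, j).
Qed.

Lemma norm_mx_le m n (x : 'M[R]_(m, n)) (C : R) : 0 <= C ->
  (forall i j, `|x i j| <= C) -> `|x| <= C.
Proof.
by move=> C0 xC; rewrite [leLHS]/Num.Def.normr /= mx_normrE; apply/bigmax_leP; split.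
Qed.

Lemma norm_row_mx m n1 n2 (u : 'M[R]_(m, n1)) (v : 'M[R]_(m, n2)) :
  `|row_mx u v| = Num.max `|u| `|v|.
Proof.
apply/eqP; rewrite eq_le; apply/andP; split.
  apply: norm_mx_le => [|i j]; first by rewrite le_max normr_ge0.
  rewrite mxE le_max; case: (fintype.split j) => k; first by rewrite coord_le_norm.
  by rewrite coord_le_norm orbT.
rewrite ge_max; apply/andP; split; apply: norm_mx_le => // i j.
  by rewrite -(row_mxEl u v) coord_le_norm.
by rewrite -(row_mxEr u v) coord_le_norm.
Qed.

Lemma norm_scalar1 (t : R) : `|(t%:M : 'rV[R]_1)| = `|t|.
Proof.
apply/eqP; rewrite eq_le; apply/andP; split.
  by apply: norm_mx_le => // i j; rewrite !ord1 mxE eqxx.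
by have := coord_le_norm (t%:M : 'rV[R]_1) 0 0; rewrite mxE eqxx.
Qed.

Lemma norm_row_cons d (u : 'rV[R]_1) (v : 'rV[R]_d) :
  `|row_mx u v : 'rV[R]_d.+1| = Num.max `|u| `|v|.
Proof. by have := norm_row_mx u v. Qed.

Lemma add_row_cons d (u u' : 'rV[R]_1) (v v' : 'rV[R]_d) :
  row_mx (u + u') (v + v') = (row_mx u v : 'rV[R]_d.+1) + row_mx u' v'.
Proof. by rewrite -add_row_mx. Qed.

Lemma row_consE d (x : 'rV[R]_d.+1) :
  x = row_mx ((x 0 0)%:M : 'rV[R]_1) (rsubmx (x : 'rV[R]_(1 + d))).
Proof.
have <- : lsubmx (x : 'rV[R]_(1 + d)) = (x 0 0)%:M.
  by rewrite [LHS]mx11_scalar mxE; congr (x _ _)%:M; apply/val_inj.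
by have := hsubmxK (x : 'rV[R]_(1 + d)) => ->.
Qed.

(** Compactness of the ball of radius [M + 1] makes the local estimates uniform. Outside that ball
    an increment of norm below 1 stays where [f] vanishes. *)
Lemma cc_unif d (M : R) (f : 'rV[R]_d -> R) : cc M f -> forall e : R, 0 < e ->
  exists2 r : R, 0 < r & forall h, `|h| < r -> forall x, `|f (x + h) - f x| < e.
Proof.
move=> [cf f0] e e0.
pose K : set 'rV[R]_d := [set x | `|x| <= M + 1].
have cK : compact K.
  apply: bounded_closed_compact.
    exists (M + 1); split; [exact: num_real|] => N MN x Kx.
    exact: le_trans Kx (ltW MN).
  rewrite (_ : K = (fun x : 'rV[R]_d => `|x|) @^-1` [set r | r <= M + 1])//.
  apply: closed_comp; last exact: closed_le.
  by move=> x _; exact: norm_continuous.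
have := (compact_near_coveringP K).1 cK _ (nbhs (0 : 'rV[R]_d))
  (fun h x => `|f (x + h) - f x| < e) _.
have ucf x : K x -> \forall x' \near x & h \near (0 : 'rV[R]_d),
    `|f (x' + h) - f x'| < e.
  move=> _.
  have e2 : 0 < e / 2 by lra.
  have /nbhs_normP[/= r r0 fx] : \forall y \near x, `|f x - f y| < e / 2.
    by move: (cf x) => /cvgrPdist_lt; apply.
  have r2 : 0 < r / 2 by lra.
  exists ([set x' | `|x - x'| < r / 2], [set h | `|0 - h| < r / 2]) => /=.
    by split; exact: nbhs_norm_lt.
  move=> [x' h] /= [xx']; rewrite sub0r normrN => hr.
  have h1 : `|f x - f (x' + h)| < e / 2.
    apply: fx => /=; rewrite opprD addrA.
    by rewrite (le_lt_trans (ler_normB _ _))//; lra.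
  have h2 : `|f x - f x'| < e / 2 by apply: fx => /=; lra.
  rewrite (_ : f (x' + h) - f x' = (f x - f x') - (f x - f (x' + h))); last by lra.
  by rewrite (le_lt_trans (ler_normB _ _))//; lra.
move=> /(_ (nbhs_filter _) ucf) /nbhs_normP [/= r r0 rK].
exists (Num.min r 1); first by rewrite lt_min r0/=.
move=> h; rewrite lt_min => /andP[hr h1] x.
have [xM|xM] := leP `|x| (M + 1).
  by apply: (rK h _ x xM); rewrite /= sub0r normrN.
rewrite !f0 ?subrr ?normr0//; first by lra.
by have := ler_normB (x + h) h; rewrite addrK => ?; lra.
Qed.

End Uniform.

(** * The iterated integral: linearity, bounds, positivity, translation invariance *)

Section IntegralRV.
Context {R : realType}.
Implicit Types M C : R.

Lemma cc_slice d M (f : 'rV[R]_d.+1 -> R) (t : R) : cc M f ->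
  cc M (fun v : 'rV[R]_d => f (row_mx t%:M v)).
Proof.
move=> cf; split.
  apply: continuousP_norm => v e e0; have [r r0 fr] := cc_unif cf e0.
  exists r => // h hr; rewrite -[t%:M in X in X - _]addr0 add_row_cons fr//.
  by rewrite norm_row_cons normr0 max_r.
by move=> v Mv; apply: cf.2; rewrite norm_row_cons lt_max Mv orbT.
Qed.

Lemma integral_rVS d (f : 'rV[R]_d.+1 -> R) :
  @integral_rV R d.+1 f = (\int[@lebesgue_measure R]_t
      integral_rV (fun v : 'rV[R]_d => f (row_mx (t%:M : 'rV[R]_1) v)))%R.
Proof. by []. Qed.

(** The three facts need one another, hence a joint induction. Linearity and the bound in dimension
    [d.+1] need the integral over slices to be integrable in the first variable, which is the third
    fact for [d]; continuity of that integral one dimension higher comes from uniform continuity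
    together with linearity and the bound just obtained. *)
Lemma integral_rV_facts d M : 0 <= M ->
  [/\ forall (c : R) (f g : 'rV[R]_d -> R), cc M f -> cc M g ->
        integral_rV (fun x => c * f x + g x) = c * integral_rV f + integral_rV g,
      forall (f : 'rV[R]_d -> R) C, cc M f -> (forall x, `|f x| <= C) ->
        `|integral_rV f| <= (M *+ 2) ^+ d * C &
      forall f : 'rV[R]_d.+1 -> R, cc M f ->
        cc M (fun t : R => integral_rV (fun v => f (row_mx (t%:M : 'rV[R]_1) v)))].
Proof.
move=> M0; elim: d => [|d [IHlin IHbd IHcc]].
  split=> // [f C _ fC|f cf]; first by rewrite expr0 mul1r; exact: fC.
  split=> /= [|t Mt]; last first.
    by apply: cf.2; rewrite norm_row_cons norm_scalar1 lt_max Mt.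
  apply: continuousP_norm => t e e0; have [r r0 fr] := cc_unif cf e0.
  exists r => // h hr; rewrite raddfD/= -[X in row_mx _ X]addr0 add_row_cons fr//.
  by rewrite norm_row_cons norm_scalar1 normr0 max_l.
have lin (c : R) (f g : 'rV[R]_d.+1 -> R) : cc M f -> cc M g ->
    integral_rV (fun x => c * f x + g x) = c * integral_rV f + integral_rV g.
  move=> cf cg.
  rewrite /= -RintegralZl//; last exact: cc_integrable (IHcc f cf).
  rewrite -RintegralD//; last 2 first.
  - apply: (@cc_integrable _ M); split=> [t|t Mt].
      exact: continuous_atM (@continuous_at_cst _ _ c t) ((IHcc f cf).1 t).
    by rewrite (IHcc f cf).2// mulr0.
  - exact: cc_integrable (IHcc g cg).
  by apply: eq_Rintegral => t _; apply: IHlin; exact: cc_slice.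
have bd (f : 'rV[R]_d.+1 -> R) C : cc M f -> (forall x, `|f x| <= C) ->
    `|integral_rV f| <= (M *+ 2) ^+ d.+1 * C.
  move=> cf fC; rewrite /= exprS -mulrA.
  apply: cc_Rintegral_le (IHcc f cf) _ => // t.
  by apply: IHbd => //; exact: cc_slice.
split=> // f cf; split=> [|t Mt]; last first.
  have f0 v : f (row_mx (t%:M : 'rV[R]_1) v) = 0.
    by apply: cf.2; rewrite norm_row_cons norm_scalar1 lt_max Mt.
  (* The slice is identically zero, so the bound with [C = 0] applies. *)
  apply/eqP; rewrite -normr_le0 -[leRHS](mulr0 ((M *+ 2) ^+ d.+1)).
  by apply: bd => [|v]; [exact: cc_slice|rewrite f0 normr0].
pose K := (M *+ 2) ^+ d.+1.
have K0 : 0 <= K by rewrite exprn_ge0// mulrn_wge0.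
apply: continuousP_norm => t e e0.
(* [K] may be zero; [K + 1] keeps the quotient meaningful. *)
have e1 : 0 < e / (K + 1) by rewrite divr_gt0//; lra.
have [r r0 fr] := cc_unif cf e1.
exists r => // h hr.
have -> (a b : R) : a - b = -1 * b + a by lra.
rewrite -lin; [|exact: cc_slice..].
apply: (@le_lt_trans _ _ (K * (e / (K + 1)))).
  apply: bd; first by apply: cc_lin; exact: cc_slice.
  move=> v; rewrite mulN1r addrC raddfD/= -[X in row_mx (_ + _) X]addr0.
  rewrite add_row_cons ltW// fr// norm_row_cons norm_scalar1 normr0 max_l//.
by rewrite mulrCA gtr_pMr// ltr_pdivrMr ?mul1r; lra.
Qed.

Lemma max0_ge0 M : 0 <= Num.max M 0. Proof. by rewrite le_max lexx orbT. Qed.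

Lemma integral_rV_lin d M (c : R) (f g : 'rV[R]_d -> R) : cc M f -> cc M g ->
  integral_rV (fun x => c * f x + g x) = c * integral_rV f + integral_rV g.
Proof.
move=> /cc_max cf /cc_max cg.
by have [+ _ _] := integral_rV_facts d (max0_ge0 M); apply.
Qed.

Lemma integral_rV_bound d M (f : 'rV[R]_d -> R) C :
  0 <= M -> cc M f -> (forall x, `|f x| <= C) ->
  `|integral_rV f| <= (M *+ 2) ^+ d * C.
Proof. by move=> M0; have [_ + _] := integral_rV_facts d M0; apply. Qed.

Lemma cc_integral_slice d M (f : 'rV[R]_d.+1 -> R) : cc M f ->
  cc (Num.max M 0) (fun t : R => integral_rV (fun v => f (row_mx (t%:M : 'rV[R]_1) v))).
Proof.
by move=> /cc_max cf; have [_ _ +] := integral_rV_facts d (max0_ge0 M); apply.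
Qed.

Lemma integral_rV_ge0 d (f : 'rV[R]_d -> R) : (forall x, 0 <= f x) ->
  0 <= integral_rV f.
Proof.
elim: d f => [f f0|d IH f f0]; first exact: f0.
by apply: Rintegral_ge0 => t _; exact: IH.
Qed.

(** The slice integrals form a continuous nonnegative function of the first coordinate with zero
    integral, so each of them is zero and the induction hypothesis applies to every slice. *)
Lemma integral_rV_eq0 d M (f : 'rV[R]_d -> R) : cc M f -> (forall x, 0 <= f x) ->
  integral_rV f = 0 -> forall x, f x = 0.
Proof.
elim: d f => [f cf f0 /= + x|d IH f cf f0 If0 x]; first by rewrite (thinmx0 x).
have If t : integral_rV (fun v => f (row_mx (t%:M : 'rV[R]_1) v)) = 0.
  apply: (cc_Rintegral_eq0 (cc_integral_slice cf) _ If0).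
  by move=> s; exact: integral_rV_ge0.
rewrite (row_consE x).
exact: (IH _ (cc_slice (x 0 0) cf) _ (If (x 0 0))).
Qed.

Lemma integral_rV_shift d M (f : 'rV[R]_d -> R) w : cc M f ->
  integral_rV (fun x => f (x + w)) = integral_rV f.
Proof.
elim: d f w => [f w cf|d IH f w cf]; first by rewrite /= (thinmx0 (0 + w)).
rewrite !integral_rVS -[in RHS](cc_Rintegral_shift (w 0 0) (cc_integral_slice cf)).
apply: eq_Rintegral => t _.
rewrite -(IH _ (rsubmx (w : 'rV[R]_(1 + d))) (cc_slice _ cf)).
congr integral_rV; apply/funext => v; congr f.
by rewrite [w in LHS]row_consE -add_row_cons raddfD.
Qed.

End IntegralRV.

(** * Smooth functions *)

Section Smooth.
Context {R : realType} {d : nat}.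
Implicit Types (f g : 'rV[R]_d -> R) (Omega K : set 'rV[R]_d) (i j : 'I_d).
Implicit Types (x : 'rV[R]_d) (s t : seq 'I_d).

Lemma near_eq_pderiv i f g x : (\forall y \near x, f y = g y) ->
  pderiv i f x = pderiv i g x.
Proof. exact: near_eq_derive. Qed.

Definition C1_on Omega f := forall x, Omega x ->
  {for x, continuous f} /\ forall i, derivable f x (delta_mx 0 i).

(** [smooth_on] quantifies over all derivative words at once. Peeling off the innermost derivative
    gives a form by order, on which closure under sums and products is an induction on [k]. *)
Fixpoint Ck_on k Omega f : Prop :=
  if k is k'.+1 then C1_on Omega f /\ forall i, Ck_on k' Omega (pderiv i f)
  else C1_on Omega f.

Lemma smooth_on_pderiv i Omega f : smooth_on Omega f -> smooth_on Omega (pderiv i f).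
Proof. by move=> sf s; rewrite -foldr_rcons; exact: sf. Qed.

Lemma smooth_onP Omega f : smooth_on Omega f <-> forall k, Ck_on k Omega f.
Proof.
split=> [+ k|sf s]; last first.
  elim/last_ind: s f sf => [|s i IH] f sf; first exact: (sf 0%N).
  by rewrite foldr_rcons; apply: IH => k; case: (sf k.+1) => _; apply.
elim: k f => [|k IH] f sf; first exact: (sf [::]).
split=> [|i]; [exact: (sf [::])|exact/IH/smooth_on_pderiv].
Qed.

Lemma Ck_onS k Omega f : Ck_on k.+1 Omega f -> Ck_on k Omega f.
Proof. by elim: k f => [f []//|k IH f [f1 fk]]; split => // i; exact: IH. Qed.

Lemma open_near Omega (P : 'rV[R]_d -> Prop) x : open Omega ->
  (forall y, Omega y -> P y) -> Omega x -> \forall y \near x, P y.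
Proof. by move=> oO OP Ox; apply: filterS OP _; exact: open_nbhs_nbhs. Qed.

Lemma eq_C1_on Omega f g : open Omega -> (forall x, Omega x -> f x = g x) ->
  C1_on Omega f -> C1_on Omega g.
Proof.
move=> oO fg f1 x Ox; have [cf df] := f1 x Ox.
have nfg := open_near oO fg Ox.
split=> [|i]; last exact: near_eq_derivable nfg (df i).
have gfx := fg x Ox; move: cf; rewrite /prop_for /continuous_at gfx.
by move=> cf; exact: (cvg_trans (near_eq_cvg nfg) cf).
Qed.

(** On an open set, equal functions agree near each point and so have equal derivatives there,
    whatever their values outside. *)
Lemma eq_Ck_on k Omega f g : open Omega -> (forall x, Omega x -> f x = g x) ->
  Ck_on k Omega f -> Ck_on k Omega g.
Proof.
move=> oO; elim: k f g => [|k IH] f g fg; first exact: eq_C1_on.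
move=> [f1 fk]; split; first exact: eq_C1_on f1.
move=> i; apply: IH (fk i) => x Ox; apply: near_eq_pderiv.
exact: open_near oO fg Ox.
Qed.

Lemma pderivD i f g x : derivable f x (delta_mx 0 i) ->
  derivable g x (delta_mx 0 i) ->
  pderiv i (fun y => f y + g y) x = pderiv i f x + pderiv i g x.
Proof. by move=> df dg; rewrite /pderiv -deriveD. Qed.

Lemma pderivM i f g x : derivable f x (delta_mx 0 i) ->
  derivable g x (delta_mx 0 i) ->
  pderiv i (fun y => f y * g y) x = pderiv i f x * g x + f x * pderiv i g x.
Proof.
move=> df dg; rewrite /pderiv [LHS](deriveM df dg) addrC; congr (_ + _).
exact: mulrC.
Qed.

Lemma pderiv_cst i (c : R) x : pderiv i (fun=> c) x = 0.
Proof. exact: derive_cst. Qed.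

Lemma C1_onD Omega f g : C1_on Omega f -> C1_on Omega g ->
  C1_on Omega (fun x => f x + g x).
Proof.
move=> f1 g1 x Ox; have [cf df] := f1 x Ox; have [cg dg] := g1 x Ox.
by split=> [|i]; [exact: continuous_atD|exact: derivableD].
Qed.

Lemma C1_onM Omega f g : C1_on Omega f -> C1_on Omega g ->
  C1_on Omega (fun x => f x * g x).
Proof.
move=> f1 g1 x Ox; have [cf df] := f1 x Ox; have [cg dg] := g1 x Ox.
by split=> [|i]; [exact: continuous_atM|exact: derivableM].
Qed.

Lemma Ck_onD k Omega f g : open Omega -> Ck_on k Omega f -> Ck_on k Omega g ->
  Ck_on k Omega (fun x => f x + g x).
Proof.
move=> oO; elim: k f g => [|k IH] f g; first exact: C1_onD.
move=> [f1 fk] [g1 gk]; split=> [|i]; first exact: C1_onD.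
apply: (eq_Ck_on oO _ (IH _ _ (fk i) (gk i))) => x Ox.
by rewrite pderivD//; [case: (f1 x Ox)|case: (g1 x Ox)].
Qed.

Lemma Ck_onM k Omega f g : open Omega -> Ck_on k Omega f -> Ck_on k Omega g ->
  Ck_on k Omega (fun x => f x * g x).
Proof.
move=> oO; elim: k f g => [|k IH] f g; first exact: C1_onM.
move=> fk1 gk1; have [f1 fk] := fk1; have [g1 gk] := gk1.
split=> [|i]; first exact: C1_onM.
apply: (eq_Ck_on oO _ (Ck_onD oO (IH _ _ (fk i) (Ck_onS gk1))
                                 (IH _ _ (Ck_onS fk1) (gk i)))) => x Ox.
by rewrite pderivM//; [case: (f1 x Ox)|case: (g1 x Ox)].
Qed.

Lemma smooth_on_cst Omega (c : R) : smooth_on Omega (fun=> c).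
Proof.
apply/smooth_onP => k; have c1 (e : R) : C1_on Omega (fun=> e).
  by move=> x _; split=> [|i]; [exact: continuous_at_cst|exact: derivable_cst].
elim: k c => [|k IH] c; first exact: c1.
split=> [|i]; first exact: c1.
by rewrite (_ : pderiv _ _ = fun=> 0)//; apply/funext => x; exact: pderiv_cst.
Qed.

Lemma eq_smooth_on Omega f g : open Omega -> (forall x, Omega x -> f x = g x) ->
  smooth_on Omega f -> smooth_on Omega g.
Proof. by move=> oO fg /smooth_onP sf; apply/smooth_onP => k; exact: eq_Ck_on (sf k). Qed.

Lemma smooth_onD Omega f g : open Omega -> smooth_on Omega f -> smooth_on Omega g ->
  smooth_on Omega (fun x => f x + g x).
Proof.
move=> oO /smooth_onP sf /smooth_onP sg; apply/smooth_onP => k; exact: Ck_onD.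
Qed.

Lemma smooth_onM Omega f g : open Omega -> smooth_on Omega f -> smooth_on Omega g ->
  smooth_on Omega (fun x => f x * g x).
Proof.
move=> oO /smooth_onP sf /smooth_onP sg; apply/smooth_onP => k; exact: Ck_onM.
Qed.

Lemma smooth_on_sum Omega (I : Type) (r : seq I) (F : I -> 'rV[R]_d -> R) :
  open Omega -> (forall a, smooth_on Omega (F a)) ->
  smooth_on Omega (fun x => \sum_(a <- r) F a x).
Proof.
move=> oO sF; elim: r => [|a r IH].
  rewrite (_ : (fun x => _) = fun=> 0); first exact: smooth_on_cst.
  by apply/funext => x; rewrite big_nil.
rewrite (_ : (fun x => _) = fun x => F a x + \sum_(b <- r) F b x).
  exact: (smooth_onD oO (sF a) IH).
by apply/funext => x; rewrite big_cons.
Qed.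

Lemma smooth_onW Omega Omega' f : Omega `<=` Omega' -> smooth_on Omega' f ->
  smooth_on Omega f.
Proof. by move=> OO sf s x /OO; exact: sf. Qed.

Lemma smooth_on_foldr s Omega f : smooth_on Omega f ->
  smooth_on Omega (foldr (@pderiv R d) f s).
Proof. by elim: s => [//|i s IH] sf; exact/smooth_on_pderiv/IH. Qed.

Lemma smooth_on_derivable Omega f x i : smooth_on Omega f -> Omega x ->
  derivable f x (delta_mx 0 i).
Proof. by move=> sf Ox; have [_ +] := sf [::] x Ox; exact. Qed.

(** The list of variables along which [mderiv] differentiates, so that multi-index derivatives can
    be handled by induction on lists. *)
Definition mword (a : 'I_d -> nat) : seq 'I_d :=
  flatten [seq nseq (a i) i | i <- enum 'I_d].

Lemma mderivE a f : mderiv a f = foldr (@pderiv R d) f (mword a).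
Proof.
rewrite /mderiv /mword; elim: (enum 'I_d) => [//|i s IH] /=.
by rewrite foldr_cat -IH; elim: (a i) => //= k ->.
Qed.

Lemma smooth_on_mderiv a Omega f : smooth_on Omega f -> smooth_on Omega (mderiv a f).
Proof. by rewrite mderivE; exact: smooth_on_foldr. Qed.

(** * Symmetry of mixed partial derivatives *)

Lemma is_derive_line (V : normedModType R) (f : V -> R) (x v : V) (s : R) :
  derivable f (x + s *: v) v ->
  is_derive s (1 : R) (fun t : R => f (x + t *: v)) ('D_v f (x + s *: v)).
Proof.
pose g (t : R) := f (x + t *: v).
have E : (fun h : R => h^-1 *: ((g \o shift s) (h *: (1 : R)) - g s)) =
     (fun h : R => h^-1 *: ((f \o shift (x + s *: v)) (h *: v) - f (x + s *: v))).
  apply/funext => h; rewrite /g /=; congr (_ *: (f _ - _)).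
  by rewrite -[h%:A]/(h * 1) mulr1 scalerDl addrCA.
by move=> df; split; rewrite /derivable /derive [X in X @ _]E.
Qed.

Lemma mvt_pderiv f i : (forall x, derivable f x (delta_mx 0 i)) ->
  forall x (h : R), 0 < h ->
  exists2 c : R, 0 < c < h & f (x + h *: delta_mx 0 i) - f x =
    h * pderiv i f (x + c *: delta_mx 0 i).
Proof.
move=> df x h h0; set v := delta_mx 0 i.
have dl (s : R) : is_derive s (1 : R) (fun t : R => f (x + t *: v))
    (pderiv i f (x + s *: v)).
  exact: is_derive_line.
have cl : {within `[0, h], continuous (fun t : R => f (x + t *: v))}.
  apply: continuous_subspaceT => u.
  by apply: differentiable_continuous; apply/derivable1_diffP; exact: ex_derive.
have [c] := MVT h0 (fun u _ => dl u) cl.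
rewrite in_itv/= scale0r addr0 subr0 => ch E; exists c => //.
by rewrite E mulrC.
Qed.

(** The mean value theorem is used twice: in direction [i] for the increment of [f] along direction
    [j], then in direction [j] for [pderiv i f]. *)
Lemma second_difference f i j x (h : R) : smooth_on setT f -> 0 < h ->
  exists a b, [/\ 0 < a < h, 0 < b < h &
    f (x + h *: delta_mx 0 i + h *: delta_mx 0 j) - f (x + h *: delta_mx 0 i)
      - (f (x + h *: delta_mx 0 j) - f x) =
    h * (h * pderiv j (pderiv i f) (x + a *: delta_mx 0 i + b *: delta_mx 0 j))].
Proof.
move=> sf h0; set v := delta_mx 0 i; set w := delta_mx 0 j.
pose g y := f (y + h *: w) + -1 * f y.
have df y : derivable f y v by exact: smooth_on_derivable sf _.
have dfh y : is_derive y v (fun y => f (y + h *: w)) ('D_v f (y + h *: w)).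
  have E : (fun k : R => k^-1 *: (((fun y => f (y + h *: w)) \o shift y) (k *: v) -
      f (y + h *: w))) =
     (fun k : R => k^-1 *: ((f \o shift (y + h *: w)) (k *: v) - f (y + h *: w))).
    by apply/funext => k /=; rewrite addrA.
  by have := df (y + h *: w); split; rewrite /derivable /derive /= E.
have dg1 y : derivable (fun y => -1 * f y) y v.
  by apply: derivableM; [exact: derivable_cst|exact: df].
have dfh1 y : derivable (fun y => f (y + h *: w)) y v by exact: ex_derive.
have dg y : derivable g y v by apply: derivableD.
have g'E y : pderiv i g y = pderiv i f (y + h *: w) - pderiv i f y.
  rewrite (pderivD (dfh1 y) (dg1 y)) (pderivM (@derivable_cst _ _ _ _ y v) (df y)).
  rewrite pderiv_cst mul0r add0r mulN1r; congr (_ - _).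
  exact: (@derive_val _ _ _ _ _ _ _ (dfh y)).
have [a ah] := mvt_pderiv dg x h0.
rewrite g'E.
have dif y : derivable (pderiv i f) y w.
  by apply: smooth_on_derivable (smooth_on_pderiv i sf) _.
have [b bh ->] := mvt_pderiv dif (x + a *: v) h0.
move=> E; exists a, b; split=> //; rewrite -E /g; lra.
Qed.

Lemma norm_delta_mx i : `|(delta_mx 0 i : 'rV[R]_d)| <= 1.
Proof.
by apply: norm_mx_le => // ? l; rewrite mxE; case: (_ && _); rewrite ?normr1 ?normr0.
Qed.

Lemma dist_delta_mx2 x i j (u v : R) : 0 <= u -> 0 <= v ->
  `|x - (x + u *: delta_mx 0 i + v *: delta_mx 0 j)| <= u + v.
Proof.
move=> u0 v0; rewrite -addrA opprD addrA subrr sub0r normrN.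
apply: (le_trans (ler_normD _ _)); rewrite !normrZ !ger0_norm//.
by rewrite lerD// ler_piMr// norm_delta_mx.
Qed.

Lemma ler_dist_half (a b c e : R) : `|a - c| < e / 2 -> `|b - c| < e / 2 ->
  `|a - b| <= e.
Proof.
by rewrite !ltr_norml ler_norml => /andP[? ?] /andP[? ?]; apply/andP; split; lra.
Qed.

(** The second difference is symmetric in the two directions. Evaluated in both orders, it equates
    the two mixed derivatives at two points close to [x], and continuity of both brings them within
    [e] of each other at [x]. *)
Lemma pderivC f i j : smooth_on setT f ->
  pderiv i (pderiv j f) = pderiv j (pderiv i f).
Proof.
move=> sf; apply/funext => x; apply/eqP; rewrite -subr_eq0 -normr_le0.
apply/ler_addgt0Pr => e e0; rewrite add0r.
have sw (a b c e' : R) : a - b - (c - e') = a - c - (b - e') by clear; lra.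
have cts k l : \forall y \near x,
    `|pderiv k (pderiv l f) x - pderiv k (pderiv l f) y| < e / 2.
  have [+ _] := sf [:: k; l] x I.
  by move=> /cvgrPdist_lt; apply; lra.
have [r r0 rP] : exists2 r : R, 0 < r & forall y, `|x - y| < r ->
    `|pderiv i (pderiv j f) x - pderiv i (pderiv j f) y| < e / 2 /\
    `|pderiv j (pderiv i f) x - pderiv j (pderiv i f) y| < e / 2.
  have /nbhs_normP[/= r1 r10 rP1] := cts i j.
  have /nbhs_normP[/= r2 r20 rP2] := cts j i.
  exists (Num.min r1 r2); first by rewrite lt_min r10.
  by move=> y; rewrite lt_min => /andP[y1 y2]; split; [exact: rP1|exact: rP2].
(* Each intermediate point is within [2 * h] of [x], which is less than [r]. *)
pose h := r / 3.
have h0 : 0 < h by rewrite /h; lra.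
have [a [b [/andP[a0 ah] /andP[b0 bh] E1]]] := second_difference j i x sf h0.
have [a' [b' [/andP[a0' ah'] /andP[b0' bh'] E2]]] := second_difference i j x sf h0.
have near (u v : R) k l : 0 < u -> u < h -> 0 < v -> v < h ->
    `|x - (x + u *: delta_mx 0 k + v *: delta_mx 0 l)| < r.
  move=> u0 uh v0 vh; apply: le_lt_trans (dist_delta_mx2 x k l (ltW u0) (ltW v0)) _.
  apply: lt_trans (ltrD uh vh) _; rewrite /h; clear -r0; lra.
have [P1 _] := rP _ (near a b j i a0 ah b0 bh).
have [_ P2] := rP _ (near a' b' i j a0' ah' b0' bh').
have E : pderiv i (pderiv j f) (x + a *: delta_mx 0 j + b *: delta_mx 0 i) =
         pderiv j (pderiv i f) (x + a' *: delta_mx 0 i + b' *: delta_mx 0 j).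
  apply: (mulfI (lt0r_neq0 h0)); apply: (mulfI (lt0r_neq0 h0)).
  rewrite [x + _ + _]addrAC in E2.
  exact: (etrans (esym E1) (etrans (sw _ _ _ _) E2)).
rewrite E in P1.
exact: ler_dist_half P1 P2.
Qed.

(** The head of [s] is located in [t] and commuted to the front past one index at a time. *)
Lemma foldr_pderiv_perm f s t : smooth_on setT f -> perm_eq s t ->
  foldr (@pderiv R d) f s = foldr (@pderiv R d) f t.
Proof.
move=> sf; elim: s t => [|i s IH] t.
  by rewrite perm_sym => /perm_nilP ->.
move=> st; have it : i \in t by rewrite -(perm_mem st) mem_head.
case/splitPr: it st => t1 t2 st.
have {}st : perm_eq (t1 ++ [:: i] ++ t2) (i :: s) by rewrite perm_sym.
move: st; rewrite perm_catCA perm_cons perm_sym => /IH st /=.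
rewrite st; elim: t1 {st} => [//|j t1 IHt] /=.
by rewrite -IHt; exact: pderivC (smooth_on_foldr _ sf).
Qed.

End Smooth.

(** * Test functions *)

Section TestFunctions.
Context {R : realType} {d : nat}.
Implicit Types (f g phi psi : 'rV[R]_d -> R) (Omega K : set 'rV[R]_d) (i j : 'I_d).
Implicit Types (x : 'rV[R]_d) (s t : seq 'I_d).

Lemma supp_eq0 phi x : ~ supp phi x -> phi x = 0.
Proof.
by move=> nx; apply/eqP/negPn/negP => /= phix; apply: nx; exact: subset_closure.
Qed.

Lemma supp_sub phi psi : (forall x, ~ supp phi x -> psi x = 0) ->
  supp psi `<=` supp phi.
Proof.
move=> h; rewrite {2}/supp (closure_id (closure _)).1; last exact: closed_closure.
apply: closure_subset => x /= /eqP psix; apply: contrapT => /h; exact: psix.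
Qed.

Lemma open_supp phi : open (~` supp phi).
Proof. exact/closed_openC/closed_closure. Qed.

Lemma test_smooth Omega phi : test_function Omega phi -> smooth_on setT phi.
Proof. by case. Qed.

Lemma test_functionT Omega phi : test_function Omega phi -> test_function setT phi.
Proof. by case. Qed.

Lemma test_function_sub Omega phi psi : test_function Omega phi ->
  smooth_on setT psi -> supp psi `<=` supp phi -> test_function Omega psi.
Proof.
move=> [_ cphi sphi] spsi sub; split => //; last exact: subset_trans sphi.
exact: subclosed_compact (@closed_closure _ _) cphi sub.
Qed.

Lemma supp_pderiv i phi : supp (pderiv i phi) `<=` supp phi.
Proof.
apply: supp_sub => x nx; rewrite -(pderiv_cst i 0 x); apply: near_eq_pderiv.
exact: (open_near (@open_supp phi) (@supp_eq0 phi) nx).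
Qed.

Lemma supp_foldr s phi : supp (foldr (@pderiv R d) phi s) `<=` supp phi.
Proof. by elim: s => [//|i s IH] /=; apply: subset_trans IH; exact: supp_pderiv. Qed.

Lemma supp_mul f phi : supp (fun x => f x * phi x) `<=` supp phi.
Proof. by apply: supp_sub => x /supp_eq0 ->; rewrite mulr0. Qed.

Lemma test_function_foldr s Omega phi : test_function Omega phi ->
  test_function Omega (foldr (@pderiv R d) phi s).
Proof.
move=> tphi; apply: test_function_sub (tphi) _ (@supp_foldr s phi).
exact: smooth_on_foldr (test_smooth tphi).
Qed.

Lemma test_function_mderiv a Omega phi : test_function Omega phi ->
  test_function Omega (mderiv a phi).
Proof. by rewrite mderivE; exact: test_function_foldr. Qed.

(** The factor [f] is uncontrolled outside [Omega]. The product is smooth on [Omega] and is zero on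
    the complement of the support of [phi]; these two open sets cover the space. *)
Lemma test_functionM Omega f phi : open Omega -> smooth_on Omega f ->
  test_function Omega phi -> test_function Omega (fun x => f x * phi x).
Proof.
move=> oO sf tphi; apply: test_function_sub (tphi) _ (@supp_mul f phi).
have sO : smooth_on Omega (fun x => f x * phi x).
  exact: (smooth_onM oO sf (smooth_onW (@subsetT _ Omega) (test_smooth tphi))).
have sC : smooth_on (~` supp phi) (fun x => f x * phi x).
  apply: (eq_smooth_on (@open_supp phi) _ (@smooth_on_cst _ _ _ 0)) => x nx.
  by rewrite (supp_eq0 nx) mulr0.
move=> s x _; have [xs|xs] := pselect (supp phi x); last exact: sC.
by apply: sO; case: tphi => _ _; exact.
Qed.

Lemma test_function_lin Omega (c : R) phi psi : test_function Omega phi ->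
  test_function Omega psi -> test_function Omega (fun x => c * phi x + psi x).
Proof.
move=> [sphi cphi Ophi] [spsi cpsi Opsi].
have sub : supp (fun x => c * phi x + psi x) `<=` supp phi `|` supp psi.
  rewrite /supp -closureU; apply: closure_subset => x /= h.
  have [/eqP px|] := boolP (phi x == 0); last by left.
  by right; move: h; rewrite px mulr0 add0r.
have oT : open [set: 'rV[R]_d] by exact: openT.
split.
- exact: (smooth_onD oT (smooth_onM oT (@smooth_on_cst _ _ _ c) sphi) spsi).
- apply: subclosed_compact (@closed_closure _ _) _ sub; exact: compactU.
- by apply: subset_trans sub _ => x [/Ophi|/Opsi].
Qed.

Lemma test_function0 Omega : test_function Omega (fun=> 0).
Proof.
have s0 : supp (fun=> 0 : R) = set0 :> set 'rV[R]_d.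
  rewrite /supp (_ : [set x | _] = set0) ?closure0//.
  by apply/seteqP; split => x //=; rewrite eqxx.
by split; [exact: smooth_on_cst|rewrite s0; exact: compact0|rewrite s0].
Qed.

Lemma test_functionZ Omega (c : R) phi : test_function Omega phi ->
  test_function Omega (fun x => c * phi x).
Proof.
move=> tphi; have := test_function_lin c tphi (test_function0 Omega).
by under eq_fun do rewrite addr0.
Qed.

Lemma test_functionD Omega phi psi : test_function Omega phi ->
  test_function Omega psi -> test_function Omega (fun x => phi x + psi x).
Proof.
move=> tphi tpsi; have := test_function_lin 1 tphi tpsi.
by under eq_fun do rewrite mul1r.
Qed.

Lemma test_function_sum Omega (I : Type) (r : seq I) (F : I -> 'rV[R]_d -> R) :
  (forall a, test_function Omega (F a)) ->
  test_function Omega (fun x => \sum_(a <- r) F a x).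
Proof.
move=> tF; elim: r => [|a r IH].
  by under eq_fun do rewrite big_nil; exact: test_function0.
by under eq_fun do rewrite big_cons; exact: test_functionD.
Qed.

Lemma compact_norm_le K : compact K ->
  exists2 M : R, 0 <= M & forall x, K x -> `|x| <= M.
Proof.
move=> /compact_bounded[M0 [_ KM]]; exists (`|M0| + 1); first by rewrite addr_ge0.
by move=> x Kx; apply: (KM (`|M0| + 1)) Kx; rewrite (le_lt_trans (ler_norm _))// ltrDl.
Qed.

Lemma supp_cc K M phi : (forall x, K x -> `|x| <= M) -> supp phi `<=` K ->
  smooth_on setT phi -> cc M phi.
Proof.
move=> KM phiK sphi; split=> [x|x Mx]; first by case: (sphi [::] x I).
apply: supp_eq0 => /phiK/KM; by rewrite leNgt Mx.
Qed.

Lemma test_function_cc Omega phi : test_function Omega phi ->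
  exists2 M : R, 0 <= M & cc M phi.
Proof.
move=> [sphi /compact_norm_le[M M0 KM] _]; exists M => //; exact: supp_cc KM _ sphi.
Qed.

Lemma compact_continuous_bound K g : compact K ->
  (forall x, K x -> {for x, continuous g}) ->
  exists2 C : R, 0 <= C & forall x, K x -> `|g x| <= C.
Proof.
move=> cK cg; have wg : {within K, continuous g}.
  by apply: continuous_in_subspaceT => x /set_mem; exact: cg.
have /compact_bounded[M0 [_ KM]] := continuous_compact wg cK.
exists (`|M0| + 1) => [|x Kx]; first by rewrite addr_ge0.
by apply: (KM (`|M0| + 1)); [rewrite (le_lt_trans (ler_norm _))// ltrDl|exists x].
Qed.

Lemma integral_test_lin Omega (c : R) phi psi : test_function Omega phi ->
  test_function Omega psi ->
  integral_rV (fun x => c * phi x + psi x) = c * integral_rV phi + integral_rV psi.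
Proof.
move=> /test_function_cc[M _ cphi] /test_function_cc[N _ cpsi].
apply: (@integral_rV_lin _ _ (Num.max M N)).
  by apply: cc_le cphi; rewrite le_max lexx.
by apply: cc_le cpsi; rewrite le_max lexx orbT.
Qed.

(** The property shared by distributions, by the integral and by operators applied to distributions,
    so that transposition is proved once for all of them. *)
Definition test_linear Omega (u : ('rV[R]_d -> R) -> R) := forall (c : R) phi psi,
  test_function Omega phi -> test_function Omega psi ->
  u (fun x => c * phi x + psi x) = c * u phi + u psi.

Lemma test_linear0 Omega u : test_linear Omega u -> u (fun=> 0) = 0.
Proof.
move=> lu; have := lu (-1) _ _ (test_function0 Omega) (test_function0 Omega).
under [X in u X = _]eq_fun do rewrite mulr0 addr0.
by rewrite mulN1r addNr.
Qed.

Lemma test_linearD Omega u phi psi : test_linear Omega u ->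
  test_function Omega phi -> test_function Omega psi ->
  u (fun x => phi x + psi x) = u phi + u psi.
Proof.
move=> lu tphi tpsi; rewrite -[X in X + _]mul1r -lu//.
by under [in RHS]eq_fun do rewrite mul1r.
Qed.

Lemma test_linearZ Omega u (c : R) phi : test_linear Omega u ->
  test_function Omega phi -> u (fun x => c * phi x) = c * u phi.
Proof.
move=> lu tphi; have := lu c _ _ tphi (test_function0 Omega).
by rewrite (test_linear0 lu) addr0 => <-; under [in RHS]eq_fun do rewrite addr0.
Qed.

Lemma test_linear_sum Omega u (I : Type) (r : seq I) (F : I -> 'rV[R]_d -> R) :
  test_linear Omega u -> (forall a, test_function Omega (F a)) ->
  u (fun x => \sum_(a <- r) F a x) = \sum_(a <- r) u (F a).
Proof.
move=> lu tF; elim: r => [|a r IH].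
  by rewrite big_nil -[RHS](test_linear0 lu); under eq_fun do rewrite big_nil.
rewrite big_cons -IH -(test_linearD lu (tF a) (test_function_sum r tF)).
by under eq_fun do rewrite big_cons.
Qed.

(** * Integration by parts *)

Lemma integral_test_linear Omega : test_linear Omega (@integral_rV R d).
Proof. by move=> c phi psi; exact: integral_test_lin. Qed.

Lemma integral_rV0 : integral_rV (fun _ : 'rV[R]_d => 0 : R) = 0 :> R.
Proof. exact: test_linear0 (@integral_test_linear setT). Qed.

(* Difference quotients have integral 0 by translation invariance, and they
   converge uniformly to the derivative. *)
Lemma integral_pderiv Omega i phi : test_function Omega phi ->
  integral_rV (pderiv i phi) = 0.
Proof.
move=> tphi; have [M M0 cphi] := test_function_cc tphi.
have tdphi := test_function_foldr [:: i] tphi.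
have cdphi : cc M (pderiv i phi).
  split=> [x|x Mx]; first by have [] := test_smooth tdphi [::] (I : setT x).
  rewrite -(pderiv_cst i 0 x); apply: near_eq_pderiv.
  have := @norm_continuous _ _ x => /cvgr_gt/(_ _ Mx); apply: filterS => y.
  exact: cphi.2.
pose v : 'rV[R]_d := delta_mx 0 i.
have v1 : `|v| <= 1 by exact: norm_delta_mx.
pose K := ((M + 1) *+ 2) ^+ d.
have K0 : 0 <= K by rewrite exprn_ge0// mulrn_wge0//; lra.
apply/eqP; rewrite -normr_le0; apply/ler_addgt0Pr => e e0; rewrite add0r.
have e1 : 0 < e / (K + 1) by rewrite divr_gt0//; lra.
have [r r0 fr] := cc_unif cdphi e1.
(* The bound 1 keeps the shifted function zero beyond radius [M + 1]; staying below [r] puts the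
   mean value point within reach of uniform continuity. *)
pose h := Num.min (r / 2) 1.
have h0 : 0 < h by rewrite lt_min ltr01 andbT; lra.
have hr : h < r by rewrite gt_min; apply/orP; left; lra.
have h1 : h <= 1 by rewrite ge_min lexx orbT.
pose q x := (- h^-1) * phi x + h^-1 * phi (x + h *: v).
have M1 : M <= M + 1 by lra.
have cphi1 := cc_le M1 cphi.
have cs0 : cc (M + 1) (fun _ : 'rV[R]_d => 0 : R).
  by split=> // x; exact: continuous_at_cst.
have cshift : cc (M + 1) (fun x => phi (x + h *: v)).
  apply: cc_le (cc_shift (h *: v) cphi).
  by rewrite lerD2l normrZ gtr0_norm// mulr_ile1// ltW.
have cs := cc_lin h^-1 cshift cs0.
have qE : q = fun x => (- h^-1) * phi x + (h^-1 * phi (x + h *: v) + 0).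
  by apply/funext => x; rewrite /q addr0.
have cq : cc (M + 1) q by rewrite qE; exact: cc_lin.
have Iq : integral_rV q = 0.
  rewrite qE (integral_rV_lin _ cphi1 cs) (integral_rV_lin _ cshift cs0).
  by rewrite (integral_rV_shift _ cphi) integral_rV0 addr0 mulNr addNr.
(* Subtracting the zero integral of [q] leaves the integral of [pderiv i phi - q], which is
   uniformly small. *)
rewrite -[integral_rV _]subr0 -Iq.
have -> (a b : R) : a - b = -1 * b + a by lra.
rewrite -(@integral_rV_lin _ _ (M + 1))//; last exact: cc_le cdphi.
apply: (@le_trans _ _ (K * (e / (K + 1)))).
  apply: integral_rV_bound; first by lra.
    by apply: cc_lin => //; exact: cc_le cdphi.
  move=> x.
  have [|c /andP[c0 ch] E] := @mvt_pderiv _ _ phi i _ x h h0.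
    by move=> y; exact: smooth_on_derivable (test_smooth tphi) _.
  have -> : q x = pderiv i phi (x + c *: delta_mx 0 i).
    apply: (mulfI (lt0r_neq0 h0)); rewrite -E /q mulrDr mulrA mulrN mulrA.
    by rewrite mulfV ?lt0r_neq0// mul1r mulN1r addrC.
  rewrite mulN1r addrC distrC ltW// fr// normrZ gtr0_norm//.
  apply: le_lt_trans hr; apply: le_trans (ltW ch).
  by rewrite ler_piMr// ltW.
by rewrite mulrCA ger_pMr// ler_pdivrMr ?mul1r; lra.
Qed.

(** The derivative of the product [f * phi] has integral 0. The product rule holds on the support of
    [phi]; elsewhere [f] need not be differentiable, but all terms vanish. *)
Lemma integral_by_parts1 Omega i f phi : open Omega -> smooth_on Omega f ->
  test_function Omega phi ->
  integral_rV (fun x => pderiv i f x * phi x) =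
  - integral_rV (fun x => f x * pderiv i phi x).
Proof.
move=> oO sf tphi; apply/eqP; rewrite -subr_eq0 opprK; apply/eqP.
have tdphi := test_function_foldr [:: i] tphi.
rewrite -(test_linearD (@integral_test_linear Omega)
  (test_functionM oO (smooth_on_pderiv i sf) tphi) (test_functionM oO sf tdphi)).
rewrite -[RHS](integral_pderiv i (test_functionM oO sf tphi)).
congr integral_rV; apply/funext => x.
have [xs|xs] := pselect (supp phi x).
  have Ox : Omega x by case: tphi => _ _; exact.
  rewrite pderivM//; first exact: smooth_on_derivable sf Ox.
  exact: smooth_on_derivable (test_smooth tphi) _.
have dx : ~ supp (pderiv i phi) x by move=> /supp_pderiv.
rewrite /= (supp_eq0 xs) (supp_eq0 dx) !mulr0 addr0; apply/esym/supp_eq0.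
by move=> /supp_pderiv /supp_mul.
Qed.

Lemma integral_by_parts s Omega f phi : open Omega -> smooth_on Omega f ->
  test_function Omega phi ->
  integral_rV (fun x => foldr (@pderiv R d) f s x * phi x) =
  (-1) ^+ size s * integral_rV (fun x => f x * foldr (@pderiv R d) phi s x).
Proof.
move=> oO sf; elim: s phi => [|i s IH] phi tphi /=; first by rewrite expr0 mul1r.
rewrite (integral_by_parts1 i oO (smooth_on_foldr s sf) tphi).
rewrite (IH _ (test_function_foldr [:: i] tphi)) exprS mulN1r mulNr.
congr (- (_ * integral_rV _)); apply/funext => x; congr (_ * _).
rewrite -foldr_rcons -[RHS]/(foldr (@pderiv R d) phi (i :: s) x).
(* Each derivative moved onto [phi] lands innermost, so the order of the word has to be restored. *)
congr (_ x); apply: foldr_pderiv_perm; first exact: test_smooth tphi.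
by rewrite perm_rcons.
Qed.

Lemma size_mword (a : 'I_d -> nat) : size (mword a) = (\sum_(i < d) a i)%N.
Proof.
rewrite /mword size_flatten /shape -map_comp sumnE big_map big_enum/=.
by apply: eq_bigr => i _; rewrite size_nseq.
Qed.

Lemma count_mword (a : 'I_d -> nat) i : count_mem i (mword a) = a i.
Proof.
rewrite /mword count_flatten -map_comp sumnE big_map big_enum/=.
rewrite (bigD1 i)//= count_nseq/= eqxx mul1n big1 ?addn0// => j ji.
by rewrite count_nseq/= (negbTE ji) mul0n.
Qed.

Lemma integral_mderiv k (a : multi_index d k) Omega f phi : open Omega ->
  smooth_on Omega f -> test_function Omega phi ->
  integral_rV (fun x => mderiv (mexp a) f x * phi x) =
  (-1) ^+ mdeg a * integral_rV (fun x => f x * mderiv (mexp a) phi x).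
Proof. by move=> *; rewrite !mderivE (@integral_by_parts _ Omega)// size_mword. Qed.

(** * Seminorms of test functions and the Leibniz estimate *)

Lemma perm_mword s : perm_eq s (mword (fun i => count_mem i s)).
Proof. by apply/allP => i _ /=; rewrite count_mword. Qed.

(** The seminorm on the right-hand side of [dist_continuous]. *)
Definition tnorm N phi : R :=
  \sum_(a : multi_index d N) sup (range (fun x => `|mderiv (mexp a) phi x|)).

Lemma test_bounded Omega phi : test_function Omega phi ->
  exists2 C : R, 0 <= C & forall x, `|phi x| <= C.
Proof.
move=> [sphi cphi _]; have [|C C0 phiC] := @compact_continuous_bound _ phi cphi.
  by move=> x _; case: (sphi [::] x I).
exists C => // x; have [/phiC//|/supp_eq0 ->] := pselect (supp phi x).
by rewrite normr0.
Qed.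

Lemma le_sup_range Omega phi x : test_function Omega phi ->
  `|phi x| <= sup (range (fun x => `|phi x|)).
Proof.
move=> /test_bounded[C _ phiC]; apply: ub_le_sup; last by exists x.
by exists C => _ [y _ <-].
Qed.

Lemma sup_range_ge0 Omega phi : test_function Omega phi ->
  0 <= sup (range (fun x => `|phi x|)).
Proof. by move=> tphi; exact: le_trans (le_sup_range 0 tphi). Qed.

Lemma foldr_le_tnorm N Omega phi s x : test_function Omega phi ->
  (size s <= N)%N -> `|foldr (@pderiv R d) phi s x| <= tnorm N phi.
Proof.
move=> tphi sN.
(* The multi-index counts the occurrences in [s]; each count is at most [N], so [inord] returns it
   unchanged. *)
pose a0 : {ffun 'I_d -> 'I_N.+1} := [ffun i => inord (count_mem i s)].
have a0E i : a0 i = count_mem i s :> nat.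
  by rewrite ffunE inordK// ltnS (leq_trans (count_size _ _)).
have a0N : (\sum_(i < d) a0 i <= N)%N.
  under eq_bigr do rewrite a0E.
  by rewrite -size_mword -(perm_size (perm_mword s)).
pose a : multi_index d N := exist _ a0 a0N.
have -> : foldr (@pderiv R d) phi s = mderiv (mexp a) phi.
  rewrite mderivE; apply: foldr_pderiv_perm; first exact: test_smooth tphi.
  rewrite (_ : mexp a = fun i => count_mem i s) ?perm_mword//.
  by apply/funext => i; rewrite -a0E.
rewrite /tnorm (bigD1 a)//=; apply: ler_wpDr.
  by apply: sumr_ge0 => b _; apply: sup_range_ge0; exact: test_function_mderiv tphi.
by apply: le_sup_range; exact: test_function_mderiv tphi.
Qed.

Lemma sup_range_le psi (C : R) : (forall x, `|psi x| <= C) ->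
  sup (range (fun x => `|psi x|)) <= C.
Proof.
by move=> psiC; apply: ge_sup; [exists `|psi 0|; exists 0|move=> _ [x _ <-]].
Qed.

Lemma foldr_pderiv_lin s (c : R) f g : smooth_on setT f -> smooth_on setT g ->
  foldr (@pderiv R d) (fun x => c * f x + g x) s =
  fun x => c * foldr (@pderiv R d) f s x + foldr (@pderiv R d) g s x.
Proof.
move=> sf sg; elim: s => [//|i s /= ->]; apply/funext => x.
have df : derivable (foldr (@pderiv R d) f s) x (delta_mx 0 i).
  exact: smooth_on_derivable (smooth_on_foldr s sf) (I : setT x).
have dg : derivable (foldr (@pderiv R d) g s) x (delta_mx 0 i).
  exact: smooth_on_derivable (smooth_on_foldr s sg) (I : setT x).
have dc := @derivable_cst _ _ _ c x (delta_mx 0 i).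
rewrite (pderivD (derivableM dc df) dg) (pderivM dc df).
by rewrite pderiv_cst mul0r add0r.
Qed.

Lemma foldr_pderivD s f g : smooth_on setT f -> smooth_on setT g ->
  foldr (@pderiv R d) (fun x => f x + g x) s =
  fun x => foldr (@pderiv R d) f s x + foldr (@pderiv R d) g s x.
Proof.
move=> sf sg; have := foldr_pderiv_lin s 1 sf sg.
by under [X in foldr _ X]eq_fun do rewrite mul1r; under [in RHS]eq_fun do rewrite mul1r.
Qed.

(** A Leibniz estimate by induction on [s]: the innermost derivative falls either on [c] or on
    [phi], hence the generality in [c] and [t]. The total number of derivatives on [phi] never
    exceeds [N], and the derivatives of [c] are bounded on [K]. *)
Lemma foldr_mul_bound Omega K : open Omega -> compact K -> K `<=` Omega ->
  forall s t c N, smooth_on Omega c -> (size s + size t <= N)%N ->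
  exists2 C : R, 0 <= C & forall phi, test_function Omega phi -> supp phi `<=` K ->
  forall x, `|foldr (@pderiv R d) (fun x => c x * foldr (@pderiv R d) phi t x) s x|
    <= C * tnorm N phi.
Proof.
move=> oO cK KO; elim/last_ind => [|s i IH] t c N sc stN /=.
  have [|C C0 cC] := @compact_continuous_bound K c cK.
    by move=> x /KO Ox; case: (sc [::] x Ox).
  exists C => // phi tphi phiK x.
  have [/phiK Kx|nx] := pselect (supp phi x).
    by rewrite normrM ler_pM// ?cC// (foldr_le_tnorm _ tphi).
  rewrite (@supp_eq0 (foldr _ phi t)); last by move=> /supp_foldr.
  rewrite mulr0 normr0 mulr_ge0//; apply: le_trans (foldr_le_tnorm x tphi stN).
  exact: normr_ge0.
rewrite size_rcons addSn in stN.
have [C C0 HC] := IH t (pderiv i c) N (smooth_on_pderiv i sc) (ltnW stN).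
have [|C' C'0 HC'] := IH (i :: t) c N sc; first by rewrite /= addnS.
exists (C + C') => [|phi tphi phiK x]; first exact: addr_ge0.
have tt := test_function_foldr t tphi.
have tit := test_function_foldr (i :: t) tphi.
rewrite foldr_rcons.
have -> : pderiv i (fun x => c x * foldr (@pderiv R d) phi t x) =
    fun x => pderiv i c x * foldr (@pderiv R d) phi t x +
             c x * foldr (@pderiv R d) phi (i :: t) x.
  apply/funext => y; have [ys|ys] := pselect (supp phi y).
    have Oy : Omega y by case: tphi => _ _; exact.
    rewrite pderivM//; first exact: smooth_on_derivable sc Oy.
    exact: smooth_on_derivable (test_smooth tt) _.
  rewrite (@supp_eq0 (foldr _ phi t)); last by move=> /supp_foldr.
  rewrite (@supp_eq0 (foldr _ phi (i :: t))); last by move=> /supp_foldr.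
  rewrite !mulr0 addr0; apply: supp_eq0.
  by move=> /supp_pderiv/supp_mul/supp_foldr.
rewrite foldr_pderivD; last 2 first.
- by apply: test_smooth (test_functionM oO _ tt); exact: smooth_on_pderiv.
- exact: test_smooth (test_functionM oO sc tit).
rewrite (le_trans (ler_normD _ _))// mulrDl.
by rewrite lerD// ?HC// HC'.
Qed.

End TestFunctions.

(** * Functionals on test functions and transposes *)

Section BoundedFunctionals.
Context {R : realType} {d : nat}.
Implicit Types (f g phi psi : 'rV[R]_d -> R) (Omega K : set 'rV[R]_d).
Implicit Types (F G : ('rV[R]_d -> R) -> R).

(** The sign condition on [C], absent from [dist_continuous], lets bounds of different orders be
    compared and added. *)
Definition test_bounded_on Omega K F := exists (C : R) (N : nat), 0 <= C /\
  forall phi, test_function Omega phi -> supp phi `<=` K -> `|F phi| <= C * tnorm N phi.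

Lemma mexp_le k (a : multi_index d k) : (size (mword (mexp a)) <= k)%N.
Proof. by rewrite size_mword; exact: (valP a). Qed.

(** Multi-indices of different orders live in different types, so each term is bounded by the whole
    of [tnorm N']; this produces the cardinality factor. *)
Lemma tnorm_le Omega N N' phi : (N <= N')%N -> test_function Omega phi ->
  tnorm N phi <= #|{: multi_index d N}|%:R * tnorm N' phi.
Proof.
move=> NN tphi; rewrite mulr_natl -sumr_const; apply: ler_sum => a _.
apply: sup_range_le => x; rewrite mderivE; apply: (foldr_le_tnorm _ tphi).
exact: leq_trans (mexp_le a) NN.
Qed.

Lemma test_bounded_onD Omega K F G : test_bounded_on Omega K F ->
  test_bounded_on Omega K G -> test_bounded_on Omega K (fun phi => F phi + G phi).
Proof.
move=> [C [N [C0 HF]]] [C' [N' [C'0 HG]]].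
exists (C * #|{: multi_index d N}|%:R + C' * #|{: multi_index d N'}|%:R), (maxn N N').
split=> [|phi tphi phiK]; first by rewrite addr_ge0// mulr_ge0.
apply: (le_trans (ler_normD _ _)); rewrite mulrDl -!mulrA; apply: lerD.
  by apply: (le_trans (HF _ tphi phiK)); rewrite ler_wpM2l// (tnorm_le _ tphi)// leq_maxl.
by apply: (le_trans (HG _ tphi phiK)); rewrite ler_wpM2l// (tnorm_le _ tphi)// leq_maxr.
Qed.

Lemma test_bounded_on_sum Omega K (I : Type) (r : seq I) (H : I -> ('rV[R]_d -> R) -> R) :
  (forall a, test_bounded_on Omega K (H a)) ->
  test_bounded_on Omega K (fun phi => \sum_(a <- r) H a phi).
Proof.
move=> bH; elim: r => [|a r IH].
  exists 0, 0%N; split=> // phi _ _; by rewrite big_nil normr0 mul0r.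
by under eq_fun do rewrite big_cons; exact: test_bounded_onD.
Qed.

Lemma test_bounded_onZ Omega K (c : R) F : test_bounded_on Omega K F ->
  test_bounded_on Omega K (fun phi => c * F phi).
Proof.
move=> [C [N [C0 HF]]]; exists (`|c| * C), N; split=> [|phi tphi phiK].
  by rewrite mulr_ge0.
by rewrite normrM -mulrA ler_wpM2l// HF.
Qed.

Lemma dist_mderiv_mul_bounded Omega K (u : distribution_on Omega) k
    (a : multi_index d k) (c : 'rV[R]_d -> R) :
  open Omega -> compact K -> K `<=` Omega -> smooth_on Omega c ->
  test_bounded_on Omega K (fun phi => u (mderiv (mexp a) (fun x => c x * phi x))).
Proof.
move=> oO cK KO sc; have [C [N HC]] := dist_continuous u cK KO.
have Hb (b : multi_index d N) : exists C' : R, 0 <= C' /\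
    forall phi, test_function Omega phi -> supp phi `<=` K -> forall x,
    `|mderiv (mexp b) (mderiv (mexp a) (fun x => c x * phi x)) x|
      <= C' * tnorm (N + k) phi.
  have [|C' C'0 HC'] := foldr_mul_bound oO cK KO
    (s := mword (mexp b) ++ mword (mexp a)) (t := [::]) (N := N + k) sc.
    by rewrite size_cat addn0 leq_add// mexp_le.
  exists C'; split=> // phi tphi phiK x; rewrite !mderivE -foldr_cat.
  exact: HC'.
have [Cb HCb] := choice Hb.
(* [C] comes from [dist_continuous] without a sign. The order [N + k] counts the derivatives of the
   seminorm and those of [a]. *)
exists (`|C| * \sum_b Cb b), (N + k)%N; split=> [|phi tphi phiK].
  by rewrite mulr_ge0// sumr_ge0// => b _; case: (HCb b).
have tc := test_functionM oO sc tphi.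
apply: (le_trans (HC _ (test_function_mderiv _ tc) _)).
  rewrite mderivE; apply: subset_trans (@supp_foldr _ _ _ _) _.
  exact: subset_trans (@supp_mul _ _ _ _) phiK.
rewrite -mulrA mulr_suml; apply: le_trans (_ : `|C| * _ <= _).
  apply: ler_wpM2r (ler_norm C); apply: sumr_ge0 => b _.
  by apply: sup_range_ge0; do 2 apply: test_function_mderiv; exact: tc.
apply: ler_wpM2l => //; apply: ler_sum => b _; apply: sup_range_le => x.
by case: (HCb b) => _; exact.
Qed.

(** The constant is a bound of [g] on [K] times the volume of a cube of side [2 * M] containing
    [K]. *)
Lemma dist_of_fun_bounded Omega K g : open Omega -> compact K -> K `<=` Omega ->
  smooth_on Omega g -> test_bounded_on Omega K (dist_of_fun g).
Proof.
move=> oO cK KO sg; have [M M0 KM] := compact_norm_le cK.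
have [//|C C0 HC] := foldr_mul_bound oO cK KO (s := [::]) (t := [::]) (N := 0%N) sg.
exists ((M *+ 2) ^+ d * C), 0%N; split=> [|phi tphi phiK].
  by rewrite mulr_ge0// exprn_ge0// mulrn_wge0.
rewrite -mulrA; apply: integral_rV_bound => //.
  apply: (supp_cc KM); first exact: subset_trans (@supp_mul _ _ _ _) phiK.
  exact: test_smooth (test_functionM oO sg tphi).
by move=> x; exact: HC.
Qed.

Lemma dist_of_fun_linear Omega g : open Omega -> smooth_on Omega g ->
  test_linear Omega (dist_of_fun g).
Proof.
move=> oO sg c phi psi tphi tpsi; rewrite /dist_of_fun.
rewrite -(integral_test_lin c (test_functionM oO sg tphi) (test_functionM oO sg tpsi)).
by congr integral_rV; apply/funext => x; rewrite mulrDr mulrCA.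
Qed.

Lemma test_linear_distribution Omega F : test_linear Omega F ->
  (forall K, compact K -> K `<=` Omega -> test_bounded_on Omega K F) ->
  exists u : distribution_on Omega, dist_fun u = F.
Proof.
move=> lF bF.
have cF K : compact K -> K `<=` Omega -> exists (C : R) (N : nat), forall phi,
    test_function Omega phi -> supp phi `<=` K -> `|F phi| <= C * tnorm N phi.
  by move=> cK KO; have [C [N [_ HF]]] := bF K cK KO; exists C, N.
by exists (DistributionOn lF cF).
Qed.

End BoundedFunctionals.

(** * Transposed operators and the duality pairing *)

Section Transpose.
Context {R : realType} {d : nat}.

(** Derivatives stay outside the products with the coefficients, so the formula matches
    [diffop_dist] term by term. *)
Definition transpose n m (A : diffop R d n m) (w : 'I_m -> 'rV[R]_d -> R) :
    'I_n -> 'rV[R]_d -> R :=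
  fun j x => \sum_(a : multi_index d (do_order A)) \sum_(i < m)
    (-1) ^+ mdeg a * mderiv (mexp a) (fun y => do_coef A a y i j * w i y) x.

Section Fixed.
Context {n m : nat} (A : diffop R d n m) (Omega : set 'rV[R]_d) (oO : open Omega).

Let coef_smooth a i j : smooth_on Omega (fun x => do_coef A a x i j).
Proof. exact: smooth_onW (@subsetT _ Omega) (do_coef_smooth a i j). Qed.

Let coef_test phi a b i j : test_function Omega phi ->
  test_function Omega (mderiv b (fun x => do_coef A a x i j * phi x)).
Proof. by move=> tphi; apply: test_function_mderiv; exact: test_functionM. Qed.

Lemma transpose_test w : (forall i, test_function Omega (w i)) ->
  forall j, test_function Omega (transpose A w j).
Proof.
move=> tw j; apply: test_function_sum => a; apply: test_function_sum => i.
exact/test_functionZ/coef_test.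
Qed.

Lemma diffop_dist_transpose u w : (forall j, test_linear Omega (u j)) ->
  (forall i, test_function Omega (w i)) ->
  \sum_(i < m) diffop_dist A u i (w i) = \sum_(j < n) u j (transpose A w j).
Proof.
move=> lu tw; rewrite /diffop_dist exchange_big/=.
transitivity (\sum_(a : multi_index d (do_order A)) \sum_(j < n) \sum_(i < m)
    (-1) ^+ mdeg a * u j (mderiv (mexp a) (fun y => do_coef A a y i j * w i y))).
  by apply: eq_bigr => a _; rewrite exchange_big.
rewrite exchange_big/=; apply: eq_bigr => j _.
rewrite /transpose (test_linear_sum _ (lu j)) => [|a]; last first.
  by apply: test_function_sum => i; exact/test_functionZ/coef_test.
apply: eq_bigr => a _; rewrite (test_linear_sum _ (lu j)) => [|i]; last first.
  exact/test_functionZ/coef_test.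
by apply: eq_bigr => i _; rewrite (test_linearZ _ (lu j))//; exact: coef_test.
Qed.

Lemma diffop_dist_linear u i : (forall j, test_linear Omega (u j)) ->
  test_linear Omega (diffop_dist A u i).
Proof.
move=> lu c phi psi tphi tpsi; rewrite /diffop_dist mulr_sumr -big_split/=.
apply: eq_bigr => a _; rewrite mulr_sumr -big_split/=; apply: eq_bigr => j _.
rewrite /dist_mul /dist_mderiv mulrCA -mulrDr -lu; [|exact: coef_test..].
congr (_ * u j _); rewrite !mderivE -foldr_pderiv_lin.
- by congr foldr; apply/funext => x; rewrite mulrDr mulrCA.
- exact: test_smooth (test_functionM oO (coef_smooth a i j) tphi).
- exact: test_smooth (test_functionM oO (coef_smooth a i j) tpsi).
Qed.

Lemma diffop_dist_bounded (u : 'I_n -> distribution_on Omega) i K : compact K ->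
  K `<=` Omega -> test_bounded_on Omega K (diffop_dist A (fun j => u j) i).
Proof.
move=> cK KO; apply: test_bounded_on_sum => a; apply: test_bounded_on_sum => j.
exact/test_bounded_onZ/dist_mderiv_mul_bounded.
Qed.

Lemma diffop_smooth f : smooth_vec_on Omega f -> smooth_vec_on Omega (A f).
Proof.
move=> sf i.
rewrite (_ : (fun x => _) = fun x => \sum_a \sum_(j < n)
    do_coef A a x i j * mderiv (mexp a) (fun y => f y j 0) x).
  apply: (smooth_on_sum _ oO) => a; apply: (smooth_on_sum _ oO) => j.
  exact: (smooth_onM oO (coef_smooth a i j) (smooth_on_mderiv _ (sf j))).
apply/funext => x; rewrite /diffop_fun summxE; apply: eq_bigr => a _.
by rewrite mxE; apply: eq_bigr => j _; rewrite mxE.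
Qed.

(** Integration by parts in each term: the distributional action on a smooth function is the
    classical one. *)
Lemma diffop_dist_of_fun f i phi : smooth_vec_on Omega f ->
  test_function Omega phi ->
  diffop_dist A (fun j => dist_of_fun (fun x => f x j 0)) i phi =
  dist_of_fun (fun x => A f x i 0) phi.
Proof.
move=> sf tphi; pose F a j x := mderiv (mexp a) (fun y => f y j 0) x *
  (do_coef A a x i j * phi x).
have tF a j : test_function Omega (F a j).
  by apply: test_functionM; [|exact/smooth_on_mderiv/sf|exact: test_functionM].
have I_lin := @integral_test_linear R d Omega.
transitivity (integral_rV (fun x => \sum_a \sum_(j < n) F a j x)).
  rewrite (test_linear_sum _ I_lin) => [|a]; last exact: test_function_sum.
  apply: eq_bigr => a _; rewrite (test_linear_sum _ I_lin)//.
  apply: eq_bigr => j _; rewrite /dist_mul /dist_mderiv /dist_of_fun.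
  by rewrite -(integral_mderiv a oO (sf j))//; exact: test_functionM.
congr integral_rV; apply/funext => x; rewrite /diffop_fun summxE mulr_suml.
apply: eq_bigr => a _; rewrite mxE mulr_suml; apply: eq_bigr => j _.
by rewrite mxE /F mulrA [_ * do_coef _ _ _ _ _]mulrC.
Qed.

Lemma dist_of_fun_transpose f w : smooth_vec_on Omega f ->
  (forall i, test_function Omega (w i)) ->
  \sum_(i < m) dist_of_fun (fun x => A f x i 0) (w i) =
  \sum_(j < n) dist_of_fun (fun x => f x j 0) (transpose A w j).
Proof.
move=> sf tw.
rewrite -(@diffop_dist_transpose (fun j => dist_of_fun (fun x => f x j 0)))//.
  by apply: eq_bigr => i _; rewrite diffop_dist_of_fun.
by move=> j; exact: dist_of_fun_linear (sf j).
Qed.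

End Fixed.

(** Nondegeneracy of the pairing: choosing [g] to be the difference [w - w'] turns the hypothesis
    into the vanishing of a sum of integrals of squares. *)
Lemma test_vec_eq n (w w' : 'I_n -> 'rV[R]_d -> R) :
  (forall j, test_function setT (w j)) -> (forall j, test_function setT (w' j)) ->
  (forall g : 'rV[R]_d -> 'cV[R]_n, smooth_vec_on setT g ->
     \sum_(j < n) dist_of_fun (fun x => g x j 0) (w j) =
     \sum_(j < n) dist_of_fun (fun x => g x j 0) (w' j)) ->
  w = w'.
Proof.
move=> tw tw' E; pose h j x := -1 * w' j x + w j x.
have th j : test_function setT (h j) by exact: test_function_lin.
have oT : open [set: 'rV[R]_d] by exact: openT.
have thh j : test_function setT (fun x => h j x * h j x).
  exact: test_functionM oT (test_smooth (th j)) (th j).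
have hhE j : integral_rV (fun x => h j x * h j x) =
    -1 * dist_of_fun (h j) (w' j) + dist_of_fun (h j) (w j).
  by rewrite -(dist_of_fun_linear oT (test_smooth (th j))).
have sum0 : \sum_j integral_rV (fun x => h j x * h j x) = 0.
  have := E (fun x => \col_j h j x) _.
  under eq_bigr => j _ do under [X in dist_of_fun X]eq_fun do rewrite mxE.
  under [X in _ = X]eq_bigr => j _ do under [X in dist_of_fun X]eq_fun do rewrite mxE.
  move=> H; under eq_bigr do rewrite hhE.
  rewrite big_split/= -mulr_sumr H ?mulN1r ?addNr// => j.
  by under eq_fun do rewrite mxE; exact: test_smooth (th j).
have hh0 j x : 0 <= h j x * h j x by rewrite -expr2 sqr_ge0.
have I0 j : integral_rV (fun x => h j x * h j x) = 0.
  move: sum0 => /eqP; rewrite psumr_eq0 => [|k _]; last exact: integral_rV_ge0.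
  by move=> /allP/(_ j (mem_index_enum _))/eqP.
apply/funext => j; apply/funext => x; have [M _ cM] := test_function_cc (thh j).
have := integral_rV_eq0 cM (hh0 j) (I0 j) x.
move=> /eqP; rewrite mulf_eq0 orbb /h mulN1r addrC subr_eq0 => /eqP; exact.
Qed.

End Transpose.

(** * Construction and verification of the solution *)

Theorem theorem3p11 (R : realType) (d n m p q : nat)
    (hd : (0 < d)%N) (hn : (0 < n)%N) (hm : (0 < m)%N)
    (hp : (0 < p)%N) (hq : (0 < q)%N)
    (A : diffop R d n m) (B : diffop R d p q)
    (B_solvable : locally_solvable B)
    (A_post : post_transmutation A B) :
  locally_solvable A.
Proof.
move=> Omega oO O0 f sf.
have [P [Q [S [T [APQB QSAT]]]]] := A_post.
have [u Bu] := B_solvable Omega oO O0 (S f) (diffop_smooth S oO sf).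
have oT : open [set: 'rV[R]_d] by exact: openT.
have lu l : test_linear Omega (u l) by exact: dist_linear.
have sTf := diffop_smooth T oO sf.
have /choice[v vE] (j : 'I_n) : exists vj : distribution_on Omega,
    dist_fun vj = fun phi => diffop_dist P (fun l => u l) j phi +
      dist_of_fun (fun x => T f x j 0) phi.
  apply: test_linear_distribution => [c phi psi tphi tpsi|K cK KO].
    rewrite (diffop_dist_linear P oO j lu)// (dist_of_fun_linear oO (sTf j))//.
    by rewrite mulrDr addrACA.
  apply: test_bounded_onD; first exact: diffop_dist_bounded.
  exact: dist_of_fun_bounded.
exists v => i phi tphi.
(* The equation is tested in one component, while the transposed identities concern vectors; [w] has
   [phi] in slot [i] and zero elsewhere. *)
pose w k x := if k == i then phi x else 0.
have tw k : test_function Omega (w k).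
  by rewrite /w; case: eqP => _ //; exact: test_function0.
have lv j : test_linear Omega (v j) by exact: dist_linear.
have sumw (H : 'I_m -> ('rV[R]_d -> R) -> R) :
    (forall k, H k (fun=> 0) = 0) -> \sum_k H k (w k) = H i phi.
  move=> H0; rewrite (bigD1 i)//= big1 ?addr0 => [|k /negbTE ki].
    by congr H; apply/funext => x; rewrite /w eqxx.
  by rewrite -[RHS](H0 k); congr H; apply/funext => x; rewrite /w ki.
rewrite -(sumw (fun k => diffop_dist A (fun j => v j) k)) => [|k]; last first.
  exact: test_linear0 (diffop_dist_linear A oO k lv).
rewrite -(sumw (fun k => dist_of_fun (fun x => f x k 0))) => [|k]; last first.
  exact: test_linear0 (dist_of_fun_linear oO (sf k)).
have tAw := transpose_test A oO tw; have tQw := transpose_test Q oO tw.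
have trPA : transpose P (transpose A w) = transpose B (transpose Q w).
  (* Test functions on [Omega] are test functions on the whole space, where the pairing is against
     global smooth [g] and the hypothesis [APQB] applies. *)
  have tAwT j := test_functionT (tAw j); have tQwT j := test_functionT (tQw j).
  apply: test_vec_eq => [||g sg].
  - exact: (transpose_test P oT tAwT).
  - exact: (transpose_test B oT tQwT).
  have sPg := diffop_smooth P oT sg; have sBg := diffop_smooth B oT sg.
  rewrite -(dist_of_fun_transpose P oT sg tAwT) -(dist_of_fun_transpose B oT sg tQwT).
  have twT k := test_functionT (tw k).
  rewrite -(dist_of_fun_transpose A oT sPg twT) -(dist_of_fun_transpose Q oT sBg twT).
  apply: eq_bigr => k _; congr (dist_of_fun _ _); apply/funext => x.
  by rewrite APQB.
have trQS j x : transpose S (transpose Q w) j x + transpose T (transpose A w) j x = w j x.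
  have tAwT k := test_functionT (tAw k); have tQwT k := test_functionT (tQw k).
  have twT k := test_functionT (tw k).
  have tSQ := transpose_test S oT tQwT; have tTA := transpose_test T oT tAwT.
  pose w' k y := transpose S (transpose Q w) k y + transpose T (transpose A w) k y.
  suff ww' : w = w' by rewrite -/(w' j x) -ww'.
  apply: test_vec_eq => // [k|g sg]; first exact: test_functionD.
  have sSg := diffop_smooth S oT sg; have sTg := diffop_smooth T oT sg.
  under [RHS]eq_bigr => k _ do
    rewrite /w' (test_linearD (dist_of_fun_linear oT (sg k)) (tSQ k) (tTA k)).
  rewrite big_split/=.
  rewrite -(dist_of_fun_transpose S oT sg tQwT) -(dist_of_fun_transpose T oT sg tAwT).
  rewrite -(dist_of_fun_transpose Q oT sSg twT) -(dist_of_fun_transpose A oT sTg twT).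
  rewrite -big_split/=; apply: eq_bigr => k _.
  have sQS := diffop_smooth Q oT sSg k; have sAT := diffop_smooth A oT sTg k.
  rewrite /dist_of_fun -(test_linearD (@integral_test_linear _ _ setT)
    (test_functionM oT sQS (twT k)) (test_functionM oT sAT (twT k))).
  congr integral_rV; apply/funext => y; rewrite -mulrDl; congr (_ * _).
  by rewrite -(QSAT g sg y) mxE.
(* From here the pairings are on [Omega] itself, since [u] and [f] are given only there. *)
have tSQ := transpose_test S oO tQw; have tTA := transpose_test T oO tAw.
rewrite (diffop_dist_transpose A oO lv tw).
under eq_bigr => j _ do rewrite vE.
rewrite big_split/= (diffop_dist_transpose P oO lu tAw) trPA.
rewrite -(diffop_dist_transpose B oO lu tQw).
under [X in X + _]eq_bigr => k _ do rewrite (Bu k _ (tQw k)).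
rewrite (dist_of_fun_transpose S oO sf tQw) (dist_of_fun_transpose T oO sf tAw).
rewrite -big_split/=; apply: eq_bigr => k _.
rewrite -(test_linearD (dist_of_fun_linear oO (sf k)) (tSQ k) (tTA k)).
by congr (dist_of_fun _ _); apply/funext => x; exact: trQS.
Qed.
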